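(* Let $\lambda$ be a nonzero cardinal, $(S,\tau_S)$ a Hausdorff topological inverse monoid, $\theta\colon S\to H_S(1_S)$ a continuous homomorphism, and let $(\mathscr{P}_\lambda(\theta,S),\tau)$ be a topological Bruck–Reilly $\lambda$-polycyclic extension of $(S,\tau_S)$ in the class of Hausdorff topological inverse semigroups. If the semigroup $S$ contains a minimal idempotent, then for all words $u,v$ of the free monoid $\lambda^*$ the subset $S_{u^{-1}v}$ is open-and-closed in the topological space $(\mathscr{P}_\lambda(\theta,S),\tau)$.
   Context: A topological inverse semigroup is an inverse semigroup with a topology for which both the operation (jointly) and the inversion are continuous. Minimality of an idempotent is with respect to the natural partial order on $E(S)$ (the set of idempotents of $S$): $e\le f$ iff $ef=fe=e$. For a nonzero cardinal $\lambda$, $\lambda^*$ is the free monoid over the alphabet $\lambda$, $\varepsilon$ is the empty word and $|a|$ is the length of a word $a$. The $\lambda$-polycyclic monoid $P_\lambda$ is the semigroup with zero $0$ and identity $1$ generated by $\{p_i\}_{i\in\lambda}\cup\{p_i^{-1}\}_{i\in\lambda}$ subject to $p_ip_i^{-1}=1$ and $p_ip_j^{-1}=0$ for $i\ne j$ (for $\lambda=1$ it is the bicyclic monoid with adjoined zero). Identifying words of $\lambda^*$ with products of the $p_i$, each nonzero element of $P_\lambda$ is uniquely of the form $a^{-1}b$ with $a,b\in\lambda^*$; the identity of $P_\lambda$ is $\varepsilon=\varepsilon^{-1}\varepsilon$. For a monoid $S$ with identity $1_S$, $H_S(1_S)$ is its group of units. Given a homomorphism $\theta\colon S\to H_S(1_S)$,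 put $\theta^0(s)=s$ and $\theta^n=\theta\circ\cdots\circ\theta$ ($n$ times). The Bruck–Reilly $\lambda$-polycyclic extension is the set $\mathscr{P}_\lambda(\theta,S)=(S\times(P_\lambda\setminus\{0\}))\sqcup\{\boldsymbol{0}\}$ with the associative operation $*$ for which $\boldsymbol{0}$ is a zero and $$(s,a_1^{-1}a_2)*(t,b_1^{-1}b_2)=\begin{cases}(\theta^{|u|}(s)t,(ua_1)^{-1}b_2), & \text{if } b_1=ua_2 \text{ for some } u\in\lambda^*,\\ (s\theta^{|v|}(t),a_1^{-1}vb_2), & \text{if } a_2=vb_1 \text{ for some } v\in\lambda^*,\\ \boldsymbol{0}, & \text{otherwise.}\end{cases}$$ For $u,v\in\lambda^*$, $S_{u^{-1}v}=\{(s,u^{-1}v)\colon s\in S\}$. $(\mathscr{P}_\lambda(\theta,S),\tau)$ is a topological Bruck–Reilly $\lambda$-polycyclic extension of $(S,\tau_S)$ in a class $\mathfrak{STS}$ of semitopological semigroups (here: Hausdorff topological inverse semigroups) if both $(S,\tau_S)$ and $(\mathscr{P}_\lambda(\theta,S),\tau)$ belong to $\mathfrak{STS}$ and the map $\Upsilon\colon(S,\tau_S)\to(\mathscr{P}_\lambda(\theta,S),\tau)$, $s\mapsto(s,\varepsilon)$, is a topological and algebraic embedding. *)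

(* Defs.v *)
From HB Require Import structures.
From mathcomp Require Import all_boot.
From mathcomp Require Import all_classical topology zify.

Set Implicit Arguments.
Unset Strict Implicit.
Unset Printing Implicit Defensive.

Local Open Scope classical_set_scope.
Local Open Scope group_scope.

(* As in PreTopologicalNmodule, no compatibility between the operation and the
   topology is required at this level. *)
#[short(type="preTopologicalSemigroupType")]
HB.structure Definition PreTopologicalSemigroup :=
  {S of monoid.Semigroup S & Topological S}.

#[short(type="preTopologicalMonoidType")]
HB.structure Definition PreTopologicalMonoid :=
  {S of monoid.Monoid S & Topological S}.

Section Semigroups.
Variable S : semigroupType.
Implicit Types x y e f : S.

Definition inverse_of x y : Prop := x * y * x = x /\ y * x * y = y.

Definition inverse_semigroup : Prop := forall x, exists! y, inverse_of x y.

Definition is_idempotent e : Prop := e * e = e.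

Definition idempotent_le e f : Prop := e * f = e /\ f * e = e.

Definition minimal_idempotent e : Prop :=
  is_idempotent e /\
  forall f, is_idempotent f -> idempotent_le f e -> f = e.

End Semigroups.

Definition group_of_units (S : monoidType) : set S :=
  [set x | exists y, x * y = 1 /\ y * x = 1].
Arguments group_of_units : clear implicits.

Record hausdorff_topological_inverse_semigroup
    (S : preTopologicalSemigroupType) : Prop := {
  htis_hausdorff : hausdorff_space S;
  htis_inverse : inverse_semigroup S;
  htis_mul_continuous : continuous (fun p : S * S => p.1 * p.2);
  htis_inv_continuous :
    exists2 inv : S -> S, forall x, inverse_of x (inv x) & continuous inv
}.

Record topological_embedding (X Y : topologicalType) (f : X -> Y) : Prop := {
  temb_injective : injective f;
  temb_continuous : continuous f;
  temb_open : forall U, open U ->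
    exists2 V, open V & f @` U = range f `&` V
}.

Definition topology_on (X : choiceType) : Type :=
  isOpenTopological.axioms_ X (Choice.class X) (Choice.class X).

Section BruckReilly.
Variables (L : choiceType) (S : monoidType).

(* [BRElt s a b] is the pair (s, a^-1 b): the words a, b of the unique normal
   form a^-1 b of a nonzero element of the polycyclic monoid over L.  The
   endomorphism is a parameter of the type because the operation depends on
   it. *)
Variant bruck_reilly (theta : {multiplicative S -> S}) : Type :=
  | BRZero
  | BRElt of S & seq L & seq L.

Variable theta : {multiplicative S -> S}.
Local Notation BR := (bruck_reilly theta).
Local Notation elt := (BRElt theta).
Local Notation zero := (BRZero theta).

(* [suffix a2 b1] says that b1 = u ++ a2, with u the prefix of b1 computed
   below; see [br_mull], [br_mulr] and [br_mul_eq0] for the three cases. *)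
Definition br_mul (x y : BR) : BR :=
  match x, y with
  | BRElt s a1 a2, BRElt t b1 b2 =>
    if suffix a2 b1 then
      let u := take (size b1 - size a2) b1 in
      elt (iter (size u) theta s * t) (u ++ a1) b2
    else if suffix b1 a2 then
      let v := take (size a2 - size b1) a2 in
      elt (s * iter (size v) theta t) a1 (v ++ b2)
    else zero
  | _, _ => zero
  end.

Lemma br_mull s a1 a2 t u b2 :
  br_mul (elt s a1 a2) (elt t (u ++ a2) b2) =
  elt (iter (size u) theta s * t) (u ++ a1) b2.
Proof. by rewrite /= suffix_suffix size_cat addnK take_size_cat. Qed.

Lemma br_mulr s a1 v b1 t b2 :
  br_mul (elt s a1 (v ++ b1)) (elt t b1 b2) =
  elt (s * iter (size v) theta t) a1 (v ++ b2).
Proof.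
case: (v =P [::]) => [->|/eqP v0] /=.
  by rewrite suffix_refl subnn take0.
rewrite ifN; first by rewrite suffix_suffix size_cat addnK take_size_cat.
apply/negP => /suffixP[w /(congr1 size)]; rewrite !size_cat => szE.
by move: v0; rewrite -size_eq0 => /eqP; lia.
Qed.

Lemma br_mul_eq0 s a1 a2 t b1 b2 :
    (forall u, b1 <> u ++ a2) -> (forall v, a2 <> v ++ b1) ->
  br_mul (elt s a1 a2) (elt t b1 b2) = zero.
Proof.
move=> nu nv /=; case: suffixP => [[u /nu]//|_].
by case: suffixP => [[v /nv]|].
Qed.

Definition br_code (x : BR) : option (S * (seq L * seq L)) :=
  if x is BRElt s a b then Some (s, (a, b)) else None.

Definition br_decode (c : option (S * (seq L * seq L))) : BR :=
  if c is Some (s, (a, b)) then elt s a b else zero.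

Lemma br_codeK : cancel br_code br_decode.
Proof. by case. Qed.

HB.instance Definition _ := Choice.copy BR (can_type br_codeK).

Lemma br_iterM n : {morph iter n theta : x y / x * y}.
Proof. elim: n => [|n IHn] x y; [by []|]. by rewrite !iterS IHn gmulfM. Qed.

Variant comparison_spec (a b : seq L) : Prop :=
  | CompL u of b = u ++ a
  | CompR v of a = v ++ b
  | CompN of (forall u, b <> u ++ a) & (forall v, a <> v ++ b).

Lemma comparisonP a b : comparison_spec a b.
Proof.
have [/suffixP[u]|nu] := boolP (suffix a b); first exact: CompL.
have [/suffixP[v]|nv] := boolP (suffix b a); first exact: CompR.
apply: CompN => w E; [move: nu|move: nv]; rewrite E suffix_suffix//.
Qed.

Lemma cat_comparison (a b c d : seq L) : a ++ b = c ++ d ->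
  (exists u, d = u ++ b) \/ (exists v, b = v ++ d).
Proof.
elim: a c => [|x a IHa] [|y c] /=; [by left; exists [::] | by right; exists (y :: c)
  | by left; exists (x :: a) | by case=> _ /IHa].
Qed.

Lemma br_mulA : associative br_mul.
Proof.
case=> [|s a1 a2] // [|t b1 b2] // [|r c1 c2] //.
  by case: (br_mul _ (elt t b1 b2)).
case: (comparisonP a2 b1) => [u ->|v ->|nu nv];
  case: (comparisonP b2 c1) => [w ->|w ->|nu' nv'].
- by rewrite !br_mull catA br_mull !br_iterM size_cat iterD -mulgA catA.
- by rewrite br_mull !br_mulr br_mull mulgA.
- by rewrite [X in br_mul _ X]br_mul_eq0// br_mull br_mul_eq0.
- rewrite br_mull br_mulr; case: (comparisonP v w) => [k ->|k ->|nk nk'].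
  + rewrite -!catA br_mull br_mull br_iterM -!iterD -size_cat.
    by rewrite !mulgA.
  + rewrite -!catA br_mulr br_mulr br_iterM -iterD -size_cat.
    by rewrite mulgA.
  + have catI (x y z : seq L) : x ++ z = y ++ z -> x = y.
      move=> E; have sz : size x = size y.
        by have := congr1 size E; rewrite !size_cat; lia.
      by move/eqP: E; rewrite eqseq_cat// eqxx andbT => /eqP.
    rewrite !br_mul_eq0// => k; rewrite catA => /catI; [exact: nk|exact: nk'|exact: nk|exact: nk'].
- by rewrite !br_mulr (catA v w c1) br_mulr br_iterM size_cat iterD mulgA catA.
- rewrite [X in br_mul _ X]br_mul_eq0// br_mulr br_mul_eq0// => k E.
    by apply: (nu' (k ++ v)); rewrite -catA.
  by case: (cat_comparison E) => [[w /nu']|[w /nv']].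
- rewrite br_mull [br_mul _ (elt t b1 b2)]br_mul_eq0// br_mul_eq0// => k E.
    by case: (cat_comparison E) => [[z /nv]|[z /nu]].
  by apply: (nv (k ++ w)); rewrite -catA.
- by rewrite br_mulr !br_mul_eq0.
- by rewrite !br_mul_eq0.
Qed.

HB.instance Definition _ := isSemigroup.Build BR br_mulA.

Definition br_emb (s : S) : BR := elt s [::] [::].

Definition br_box (u v : seq L) : set BR := [set elt s u v | s in [set: S]].

Definition br_space (tau : topology_on BR) : preTopologicalSemigroupType :=
  HB.pack BR (tau : isOpenTopological.axioms_ BR _ _).

Lemma br_space_openE (tau : topology_on BR) (A : set (br_space tau)) :
  open A = isOpenTopological.op tau A.
Proof.
rewrite propeqE; split=> [|oA]; last by rewrite openE => x Ax; exists A; split.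
rewrite openE => oA.
have -> : A = \bigcup_(i : {B | isOpenTopological.op tau B /\ B `<=` A}) sval i.
  apply/seteqP; split=> [x Ax|x [[B /= [_ BA]] _ /BA//]].
  by have [B [oB Bx BA]] := oA x Ax; exists (exist _ B (conj oB BA)).
by apply: isOpenTopological.op_bigU => -[B []].
Qed.

End BruckReilly.
Arguments br_emb L {S} theta s.
Arguments br_box {L S} theta u v.

Record topological_bruck_reilly_extension
    (STS : preTopologicalSemigroupType -> Prop)
    (L : choiceType) (S : preTopologicalMonoidType)
    (theta : {multiplicative S -> S})
    (tau : topology_on (bruck_reilly L theta)) : Prop := {
  tbr_base : STS S;
  tbr_ext : STS (br_space tau);
  tbr_emb_morph : {morph br_emb L theta : x y / x * y};
  tbr_emb_topological :
    topological_embedding (br_emb L theta : S -> br_space tau)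
}.

(* Main.v *)
Require Import Defs.
From HB Require Import structures.
From mathcomp Require Import all_boot.
From mathcomp Require Import all_classical topology zify.

(* Write B(u, v) for S_{u^-1 v}, p_u for (1, u) and p_u^-1 for (1, u^-1).
   - B([::], [::]) is open: given a letter i, with idempotent E = (1, i^-1 i), it
     is cut out by the open conditions E x <> x, x E <> x, p_i x <> 0 and
     x p_i^-1 <> 0.
   - B([::], [::]) is closed: if e is a minimal idempotent of S and z = e x e,
     it is cut out by the closed conditions z z^-1 = e and z^-1 z = e.
   - The preimage of B([::], [::]) under x |-> p_u x p_v^-1 is the union of the
     B(a, b) such that u = w a and v = w b for some w.  If u and v start with
     the same letter, dropping it from both removes exactly B(u, v) from this
     union; hence B(u, v) is a clopen preimage, or a difference of two. *)

Set Implicit Arguments.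
Unset Strict Implicit.
Unset Printing Implicit Defensive.

Local Open Scope classical_set_scope.
Local Open Scope group_scope.

Lemma closed_equalizer (X Y : topologicalType) (f g : X -> Y) :
    hausdorff_space Y -> continuous f -> continuous g ->
  closed [set x | f x = g x].
Proof.
move=> hY cf cg x clx; apply: hY => A B nA nB.
have nAB : nbhs x (f @^-1` A `&` g @^-1` B).
  by apply: filterI; [exact: cf|exact: cg].
have [y [/= fgy [Ay By]]] := clx _ nAB.
by exists (f y); split=> //; rewrite fgy.
Qed.

(** * Inverses below a minimal idempotent *)

Section InverseSemigroup.
Variable S : semigroupType.
Hypothesis invS : inverse_semigroup S.
Implicit Types e s t x y : S.

Lemma inverse_of_uniq x y z : inverse_of x y -> inverse_of x z -> y = z.
Proof.
by move=> xy xz; have [w [_ w_uniq]] := invS x; rewrite -(w_uniq y) ?(w_uniq z).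
Qed.

(** Once [y] is known to be fixed by [e] on both sides, [x * y] and [y * x] are idempotents below
    [e], and minimality applies. Hence e S e is a group with identity [e]. *)
Lemma minimal_idempotent_inverse e x y : minimal_idempotent e ->
  e * x = x -> x * e = x -> inverse_of x y ->
  x * y = e /\ y * x = e.
Proof.
move=> e_min ex xe xy; have [xyx yxy] := xy.
have idxy : is_idempotent (x * y) by rewrite /is_idempotent mulgA xyx.
have idyx : is_idempotent (y * x) by rewrite /is_idempotent mulgA yxy.
(* [e * y * e] is another inverse of [x]; this avoids having to prove that
   idempotents commute. *)
have eye : e * y * e = y.
  apply: inverse_of_uniq (xy); split.
    by rewrite !mulgA xe -(mulgA _ e) ex.
  have -> : e * y * e * x * (e * y * e) = e * (y * (e * x * e) * y) * e.
    by rewrite !mulgA.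
  by rewrite ex xe yxy.
have [ide min_e] := e_min.
have ye : y * e = y by rewrite -eye -!mulgA ide.
have ey : e * y = y by rewrite -eye !mulgA ide.
by split; apply: min_e => //; split; rewrite ?mulgA ?ex ?ey // -mulgA ?xe ?ye.
Qed.

End InverseSemigroup.

(** [f 1] is both idempotent and invertible, and cancelling it leaves [1]. *)
Lemma multiplicative_units1 (S : monoidType) (f : {multiplicative S -> S}) :
  range f `<=` group_of_units S -> f 1 = 1.
Proof.
move=> unit_f; have [|y [fy _]] := unit_f (f 1); first by exists 1.
by rewrite -[LHS]mulg1 -[X in _ * X]fy mulgA -gmulfM mulg1.
Qed.

(** * Word computations in the extension *)

Section BruckReillyAlgebra.
Variables (L : choiceType) (S : monoidType) (theta : {multiplicative S -> S}).
Local Notation BR := (bruck_reilly L theta).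
Local Notation elt := (@BRElt L S theta).
Local Notation zero := (@BRZero L S theta).
Implicit Types (x y : BR) (s t : S) (a b c d u v : seq L).

(** The left word of a nonzero product ends with the left word of its first factor, so it can be
    empty only if the latter is. *)
Lemma br_mul_left_nil x y s b : br_mul x y = elt s [::] b ->
  exists t d, x = elt t [::] d.
Proof.
case: x y => [|t c d] [|r c' d'] //= E; exists t, d.
move: E; do 2?case: ifP => //= _; case=> _ cE _; last by rewrite cE.
by move/(congr1 size): cE; rewrite size_cat; case: c => //= ? ?; lia.
Qed.

Lemma br_mul_right_nil x y s a : br_mul x y = elt s a [::] ->
  exists t c, y = elt t c [::].
Proof.
case: x y => [|r c' d'] [|t c d] //= E; exists t, c.
move: E; do 2?case: ifP => //= _; case=> _ _ dE; first by rewrite dE.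
by move/(congr1 size): dE; rewrite size_cat; case: d => //= ? ?; lia.
Qed.

Lemma br_mul_emb_left e s a b :
  br_mul (br_emb L theta e) (elt s a b) = elt (iter (size a) theta e * s) a b.
Proof. by have := br_mull theta e [::] [::] s a b; rewrite !cats0. Qed.

Lemma br_mul_emb_right e s a b :
  br_mul (elt s a b) (br_emb L theta e) = elt (s * iter (size b) theta e) a b.
Proof. by have := br_mulr theta s a b [::] e [::]; rewrite !cats0. Qed.

Lemma br_emb_inverse s t :
  inverse_of s t -> inverse_of (br_emb L theta s) (br_emb L theta t).
Proof.
by case=> sts tst; split; [rewrite -[in RHS]sts|rewrite -[in RHS]tst].
Qed.

Lemma br_mul_nil_left t u s a b r d :
    br_mul (elt t [::] u) (elt s a b) = elt r [::] d ->
  exists2 w, u = w ++ a & d = w ++ b.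
Proof.
case: (comparisonP u a) => [w ->|w ->|nu nv]; last by rewrite br_mul_eq0.
  by rewrite br_mull cats0 => -[_ -> <-]; exists [::].
by rewrite br_mulr => -[_ <-]; exists w.
Qed.

Lemma br_mul_nil t u v r s :
  br_mul (elt t [::] u) (elt r v [::]) = elt s [::] [::] -> u = v.
Proof. by case/br_mul_nil_left => w ->; rewrite cats0 => <-. Qed.

Definition br_shift u v x : BR :=
  br_mul (br_mul (elt 1 [::] u) x) (elt 1 v [::]).

Lemma br_shiftP u v x : br_box theta [::] [::] (br_shift u v x) <->
  exists w, exists2 y, br_box theta y.1 y.2 x & u = w ++ y.1 /\ v = w ++ y.2.
Proof.
split=> [[s _]|[w [[a b] /= [s _ <-] [-> ->]]]]; last first.
  rewrite /br_shift br_mulr; exists (1 * iter (size w) theta s * 1) => //.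
  exact/esym/(br_mull theta _ [::] (w ++ b) 1 [::] [::]).
rewrite /br_shift; case: x => [|t a b] // /esym E.
(* The empty left word of the whole product passes to the inner one, so [a] is absorbed by [u]; the
   empty right word then forces the remaining word to be [v]. *)
have [r [d E']] := br_mul_left_nil E.
have [w uE dE] := br_mul_nil_left E'.
move: E; rewrite E' => /br_mul_nil dv.
by exists w; exists (a, b); [exists t|rewrite -dv].
Qed.

Lemma br_box_shift_cons (i j : L) u v : br_box theta (i :: u) (j :: v) =
  if i == j then
    [set x | br_box theta [::] [::] (br_shift (i :: u) (i :: v) x)] `\`
    [set x | br_box theta [::] [::] (br_shift u v x)]
  else [set x | br_box theta [::] [::] (br_shift (i :: u) (j :: v) x)].
Proof.
apply/seteqP; split=> x.
  move=> bx; case: ifP => [/eqP ij|_]; last first.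
    by apply/br_shiftP; exists [::], (i :: u, j :: v).
  subst j; split; first by apply/br_shiftP; exists [::], (i :: u, i :: v).
  (* The left word of [x] is [i :: u], too long to be a suffix of [u]. *)
  move=> /br_shiftP[w [[a b] /= [s _ sx] [uE _]]].
  move: bx; rewrite -sx => -[t _ [_ aE _]].
  by move/(congr1 size): uE; rewrite -aE size_cat /=; lia.
(* An empty [w] gives the box itself. The first letter of a nonempty [w] is both [i] and [j]: if
   they agree, dropping it puts [x] in the removed set; otherwise this is absurd. *)
case: ifP => [/eqP <-|ij].
  move=> [] /br_shiftP[[|k w] [[a b] /= bx [uE vE]]].
    by rewrite uE vE.
  by case; apply/br_shiftP; case: uE vE => _ -> [_ ->]; exists w, (a, b).
move=> /br_shiftP[[|k w] [[a b] /= bx [uE vE]]]; first by rewrite uE vE.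
by case: uE vE ij => -> _ [-> _]; rewrite eqxx.
Qed.

(** An empty word has no nonempty prefix [w] to split off, so the preimage is a single box. *)
Lemma br_box_shift_nil u v : u = [::] \/ v = [::] ->
  br_box theta u v = [set x | br_box theta [::] [::] (br_shift u v x)].
Proof.
move=> uv; apply/seteqP; split=> x.
  by move=> bx; apply/br_shiftP; exists [::], (u, v).
move=> /br_shiftP[[|k w] [[a b] /= bx [uE vE]]]; first by rewrite uE vE.
by case: uv => uv; [move: uE|move: vE]; rewrite uv.
Qed.

Hypothesis theta1 : theta 1 = 1.

Lemma iter_theta1 n : iter n theta 1 = 1.
Proof. by elim: n => //= n ->. Qed.

(** Suppose the left word of [x] is nonempty. If its last letter is [i], then the idempotent fixes
    [x] from the left, since [theta] preserves [1]; otherwise left multiplication by p_i kills [x].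
    The right word is treated symmetrically, and zero is fixed by the idempotent. *)
Lemma br_box_nilE i : br_box theta [::] [::] =
  [set x | [/\ br_mul (elt 1 [:: i] [:: i]) x <> x,
               br_mul x (elt 1 [:: i] [:: i]) <> x,
               br_mul (elt 1 [::] [:: i]) x <> zero &
               br_mul x (elt 1 [:: i] [::]) <> zero]].
Proof.
apply/seteqP; split=> x.
  by move=> [s _ <-]; split.
case: x => [|s a b] [] // nl nr zl zr.
case: (comparisonP [:: i] a) => [w aE|[|k w] iE|na ni].
- by case: nl; rewrite aE (br_mull theta) iter_theta1 mul1g.
- by case: nl; rewrite -(iE : [:: i] = a) (br_mull theta _ _ _ _ [::]) mul1g.
- case: a {zl nl} nr zr iE => [nr zr _|? ? _ _ /(congr1 size)/=]; last first.
    by rewrite size_cat /=; lia.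
  case: (comparisonP [:: i] b) => [w' bE|[|k' w'] iE|na ni].
  + by case: nr; rewrite bE (br_mulr theta) iter_theta1 mulg1.
  + by case: nr; rewrite -(iE : [:: i] = b) (br_mulr theta _ _ [::]) mulg1.
  + case: b {zr nr} iE => [_|? ? /(congr1 size)/=]; first by exists s.
    by rewrite size_cat /=; lia.
  + by case: zr; exact: br_mul_eq0.
- by case: zl; exact: br_mul_eq0.
Qed.

End BruckReillyAlgebra.

Lemma continuousM (S : preTopologicalSemigroupType) (T : topologicalType)
    (f g : T -> S) : continuous (fun p : S * S => p.1 * p.2) ->
  continuous f -> continuous g -> continuous (fun x => f x * g x).
Proof.
move=> cM cf cg x.
apply: (@continuous2_cvg _ _ _ _ _ _ _ _ (fun a b : S => a * b)).
- exact: cM (f x, g x).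
- exact: cf.
- exact: cg.
Qed.

(** * Open and closed boxes *)

Section BruckReillyTopology.
Variables (L : choiceType) (S : preTopologicalMonoidType).
Variables (theta : {multiplicative S -> S}).
Variable tau : topology_on (bruck_reilly L theta).
Hypothesis tauP : hausdorff_topological_inverse_semigroup (br_space tau).
Local Notation P := (br_space tau).
Local Notation elt := (@BRElt L S theta).
Local Notation zero := (@BRZero L S theta).

Lemma br_continuousM (f g : P -> P) : continuous f -> continuous g ->
  continuous ((fun x => br_mul (f x) (g x)) : P -> P).
Proof. exact: continuousM (htis_mul_continuous tauP). Qed.

Lemma br_continuous_cst (c : P) : continuous (fun _ : P => c).
Proof. exact: (@cst_continuous P P). Qed.

Lemma br_continuous_id : continuous (fun x : P => x).
Proof. by move=> x; exact: cvg_id. Qed.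

Lemma br_open_neq (f g : P -> P) : continuous f -> continuous g ->
  open [set x | f x <> g x].
Proof.
move=> cf cg; rewrite -closedC.
have -> : ~` [set x | f x <> g x] = [set x | f x = g x].
  by apply/seteqP; split=> x /=; [exact: contrapT|move=> fgx; exact].
exact: closed_equalizer (htis_hausdorff tauP) cf cg.
Qed.

Lemma br_box_nil_open : inhabited L -> theta 1 = 1 ->
  open (br_box theta [::] [::] : set P).
Proof.
move=> [i] theta1; rewrite (br_box_nilE theta1 i).
set A := (X in open X).
have -> : A = [set x | br_mul (elt 1 [:: i] [:: i]) x <> x] `&`
   [set x | br_mul x (elt 1 [:: i] [:: i]) <> x] `&`
   [set x | br_mul (elt 1 [::] [:: i]) x <> zero] `&`
   [set x | br_mul x (elt 1 [:: i] [::]) <> zero].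
  by apply/seteqP; split=> x /= => [[]|[[[]]]].
by do 3?apply: openI; apply: br_open_neq;
  do 1?apply: br_continuousM;
  do ?[exact: br_continuous_cst|exact: br_continuous_id].
Qed.

Lemma br_box_nil_closed (e : S) : inverse_semigroup S -> minimal_idempotent e ->
  closed (br_box theta [::] [::] : set P).
Proof.
move=> invS e_min; have [ide _] := e_min.
have [inv invP cinv] := htis_inv_continuous tauP.
pose e0 : P := br_emb L theta e.
(* Compression by [e0] sends the box of empty words into the group e S e, where a product with the
   inverse takes the single value [e]. *)
pose z (x : P) : P := br_mul (br_mul e0 x) e0.
have cz : continuous z.
  by do 2?apply: br_continuousM;
    do ?[exact: br_continuous_cst|exact: br_continuous_id].
have -> : (br_box theta [::] [::] : set P) =
    [set x | br_mul (z x) (inv (z x)) = e0] `&`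
    [set x | br_mul (inv (z x)) (z x) = e0].
  apply/seteqP; split=> x.
    move=> [s _ <-].
    have zE : z (elt s [::] [::]) = br_emb L theta (e * s * e) by [].
    have [t [st _]] := invS (e * s * e).
    (* By uniqueness of inverses in the extension, [inv] agrees with inversion in [S] here. *)
    have iE : inv (z (elt s [::] [::])) = br_emb L theta t.
      apply: (inverse_of_uniq (htis_inverse tauP)) (invP _) _.
      by rewrite zE; exact: br_emb_inverse.
    have ez : e * (e * s * e) = e * s * e by rewrite !mulgA ide.
    have ze : e * s * e * e = e * s * e by rewrite -mulgA ide.
    have [st1 ts1] := minimal_idempotent_inverse invS e_min ez ze st.
    by split; rewrite /mkset iE zE /e0;
      [rewrite -[in RHS]st1|rewrite -[in RHS]ts1].
  (* The first equation makes the left word of [z x] empty, the second its right word.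
     Multiplication by [e0] changes only the component in [S], so both words of [x] are empty
     too. *)
  move=> [/br_mul_left_nil[s [b zE]] /br_mul_right_nil[s' [a]]].
  rewrite zE => -[_ _ b0]; rewrite {}b0 in zE.
  case: x zE => [//|t c d].
  by rewrite /z br_mul_emb_left br_mul_emb_right => -[_ -> ->]; exists t.
have cl (f g : P -> P) : continuous f -> continuous g ->
    closed [set x | f x = g x].
  exact: closed_equalizer (htis_hausdorff tauP).
have czi : continuous (inv \o z).
  by move=> x; apply: continuous_comp; [exact: cz|exact: cinv].
by apply: closedI; apply: cl; do 1?apply: br_continuousM => //;
  exact: br_continuous_cst.
Qed.

Lemma br_shift_clopen u v : clopen (br_box theta [::] [::] : set P) ->
  clopen ([set x | br_box theta [::] [::] (br_shift u v x)] : set P).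
Proof.
move=> cb; apply: (@preimage_clopen P P (@br_shift L S theta u v)) => //.
by do 2?apply: br_continuousM;
  do ?[exact: br_continuous_cst|exact: br_continuous_id].
Qed.

End BruckReillyTopology.

Theorem mainTheorem13 (L : choiceType) (S : preTopologicalMonoidType)
    (theta : {multiplicative S -> S})
    (tau : topology_on (bruck_reilly L theta)) :
  inhabited L ->
  hausdorff_topological_inverse_semigroup S ->
  range theta `<=` group_of_units S ->
  continuous theta ->
  topological_bruck_reilly_extension
    hausdorff_topological_inverse_semigroup tau ->
  (exists e : S, minimal_idempotent e) ->
  forall u v : seq L, clopen (br_box theta u v : set (br_space tau)).
Proof.
move=> inhL SP unit_theta _ [_ tauP _ _] [e e_min] u v.
have cb : clopen (br_box theta [::] [::] : set (br_space tau)).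
  split; last exact: br_box_nil_closed (htis_inverse SP) e_min.
  exact: br_box_nil_open (multiplicative_units1 unit_theta).
have cs a b := br_shift_clopen tauP a b cb.
case: u v => [|c u] [|d v]; try by rewrite br_box_shift_nil; auto.
rewrite br_box_shift_cons; case: ifP => // _.
rewrite setDE; apply: clopenI => //; exact: (@clopenC _ _ set0).
Qed.
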